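(* Let $m \geq 4$ be an even integer and let $T$ be a Salem polynomial of degree $m$, vanishing at a Salem number $\beta$, having simple roots and such that $T(1) \neq 0$ and $T(-1) \neq 0$. Let $q, q^{\dagger} \geq 2$ be integers, and let $P \in E_{T,q}^{+}$ and $P^{\dagger} \in E_{T,q^{\dagger}}^{+}$ be two monic expansive polynomials over $T$ of degree $m$. Then $P + P^{\dagger} - T$ is a monic expansive polynomial of degree $m$ over $T$, and it belongs to $E_{T,q+q^{\dagger}-1}^{+}$. The internal law $$(P, P^{\dagger}) \mapsto P \oplus P^{\dagger} := P + P^{\dagger} - T$$ defines a commutative semigroup structure on $\mathcal{P}_T^{+} \cup \{T\}$, where $T$ is the neutral element.
   Context: For a polynomial $P$ of degree $n$, $P^{*}(z) = z^{n} P(1/z)$; $P$ is reciprocal if $P^*=P$. An expansive polynomial is a polynomial with real coefficients, of degree $\geq 1$, all of whose complex roots have modulus strictly greater than $1$. A Salem number is a real algebraic integer $\theta>1$ all of whose other Galois conjugates have modulus $\leq 1$, at least one of them having modulus $1$. A Salem polynomial is a monic reciprocal polynomial with integer coefficients having exactly one zero (of multiplicity $1$) of modulus $>1$, this zero being a real number $>1$, and having at least one zero on the unit circle. For an integer $q \geq 2$, $E_{T,q}^{+}$ is the set of monic expansive polynomials $P \in \mathbb{Z}[z]$ of degree $m$ ''over $T$'', i.e. satisfying $(z-1)T(z) = zP(z) - P^{*}(z)$, with $P(0) = q$. Moreover $\mathcal{P}_T^{+} := \bigcup_{q \geq 2} E_{T,q}^{+}$. *)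

(* Defs.v *)
From HB Require Import structures.
From mathcomp Require Import all_boot all_order all_algebra.
From mathcomp Require Import classical_sets reals.
From mathcomp Require Import complex.

Set Implicit Arguments.
Unset Strict Implicit.
Unset Printing Implicit Defensive.

Import Order.TTheory GRing.Theory Num.Theory.
Local Open Scope ring_scope.
Local Open Scope complex_scope.
Local Open Scope classical_set_scope.

(* P^*(z) = z^(deg P) P(1/z), as the polynomial with reversed coefficients;
   see recipE. *)
Definition recip (A : nzRingType) (p : {poly A}) : {poly A} :=
  \poly_(i < size p) p`_((size p).-1 - i).

Lemma recipE (F : fieldType) (p : {poly F}) (x : F) : x != 0 ->
  (recip p).[x] = x ^+ (size p).-1 * p.[x^-1].
Proof.
move=> x0; rewrite /recip horner_poly horner_coef mulr_sumr.
rewrite (reindex_inj rev_ord_inj) /=; apply: eq_bigr => i _.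
have le_i : (i <= (size p).-1)%N by rewrite -ltnS (ltn_predK (ltn_ord i)).
have -> : (size p - i.+1 = (size p).-1 - i)%N by rewrite -subn1 -subnDA.
by rewrite subKn // mulrCA exprVn expfB_cond ?(negPf x0).
Qed.

Definition reciprocal (A : nzRingType) (p : {poly A}) : Prop := recip p = p.

Section Definitions.
Variable R : realType.
Local Notation C := R[i].

Definition expansive (p : {poly R}) : Prop :=
  (1 < size p)%N /\
  forall z : C, root (map_poly (real_complex R) p) z -> 1 < `|z|.

(* z is a root of the minimal polynomial of x over the rationals. *)
Definition galois_conjugate (x z : C) : Prop :=
  exists p : {poly rat}, [/\ p \is monic, irreducible_poly p,
    root (map_poly ratr p) x & root (map_poly ratr p) z].

Definition salem_number (t : R) : Prop :=
  [/\ integralOver (intr : int -> R) t,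
      1 < t,
      forall z : C, galois_conjugate t%:C z -> z != t%:C -> `|z| <= 1
    & exists z : C, [/\ galois_conjugate t%:C z, z != t%:C & `|z| = 1]].

Definition salem_polynomial (T : {poly int}) : Prop :=
  let TC : {poly C} := map_poly intr T in
  [/\ T \is monic,
      reciprocal T,
      exists t : R, [/\ 1 < t, root TC t%:C, mup t%:C TC = 1%N
        & forall z : C, root TC z -> 1 < `|z| -> z = t%:C]
    & exists z : C, root TC z /\ `|z| = 1].

Definition simple_roots (T : {poly int}) : Prop :=
  let TC : {poly C} := map_poly intr T in
  forall z : C, root TC z -> mup z TC = 1%N.

Definition poly_over (T P : {poly int}) : Prop :=
  ('X - 1) * T = 'X * P - recip P.

Definition Eplus (T : {poly int}) (q : int) : set {poly int} :=
  [set P | [/\ P \is monic, expansive (map_poly intr P), size P = size T,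
               poly_over T P & P.[0] = q]].

Definition Pplus (T : {poly int}) : set {poly int} :=
  \bigcup_(q in [set q : int | 2 <= q]) Eplus T q.

End Definitions.

Definition oplus (T P Q : {poly int}) : {poly int} := P + Q - T.

Record commutative_semigroup_on (U : Type) (S : set U) (op : U -> U -> U) :
    Prop := CommutativeSemigroupOn {
  csg_closed : forall x y, S x -> S y -> S (op x y);
  csg_assoc : forall x y z, S x -> S y -> S z ->
    op x (op y z) = op (op x y) z;
  csg_comm : forall x y, S x -> S y -> op x y = op y x }.

Definition neutral_on (U : Type) (S : set U) (op : U -> U -> U) (e : U) :
    Prop :=
  S e /\ forall x, S x -> op e x = x /\ op x e = x.

(* Main.v *)
Require Import Defs.
From mathcomp Require Import all_boot all_order all_algebra.
From mathcomp Require Import classical_sets reals.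
From mathcomp Require Import complex.
From mathcomp Require Import polyrcf.
From mathcomp Require Import ring zify.

Set Implicit Arguments.
Unset Strict Implicit.
Unset Printing Implicit Defensive.

Import Order.TTheory GRing.Theory Num.Theory.
Local Open Scope ring_scope.
Local Open Scope classical_set_scope.

(** Write an expansive polynomial over T as P = T + A.  The relation
    (z - 1) T = z P - P^* says that P^* = T + z A, and since T is reciprocal this
    amounts to z^m A(1/z) = z A(z).  The operation of the theorem adds the parts A,
    so everything is formal except one fact: if T + A and T + A' are expansive,
    then so is T + A + A'.  Expansiveness of T + A is not visibly a linear
    condition on A; the proof extracts from it positivity conditions that are
    additive in A and leave no zero of the sum in the closed disc.

    In the variable x = z + 1/z one has T = z^(m/2) U(x) and
    A = (z + 1) z^(m/2 - 1) V(x), where the roots of U are simple and real: those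
    in (-2, 2) come from the zeros of T on the unit circle, and one root above 2
    comes from the Salem root t and its inverse.  The linear data are the residues
    of V/U.  In terms of z they are the numbers
      weight T A r = (1 - 1/r) A(r) / T'(r),   r a root of T.

    Expansiveness makes all of them positive (member_weight_gt0).  At t and 1/t
    this is a matter of signs of real polynomials: P > 0 on [0, 1], because
    P(0) > 0 and P has no root there.  At a root z of T on the unit circle it is a
    boundary Schwarz lemma: P^*/P maps the disc to itself and fixes every root of
    T in the closed disc, in particular the interior point 1/t, and this forces
    the sign at z.  The inequality is proved algebraically: the Hermitian kernel
    of P is a sum of squares (schur_kernel), and the weight at z is, up to a
    positive factor, the value of this kernel on a vector supported at z and 1/t
    (kernel_two_point).

    Conversely, let S = P + P' - T = T + A.  Its weights are sums of those of P and
    P', hence positive.  Suppose that S vanishes at z with |z| <= 1.  Then T does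
    not vanish at z, since otherwise A and the weight would, and z <> 0 since
    S(0) = P(0) + P'(0) - 1 > 0.  The partial fraction expansion of V/U in x
    (symmetric_partial_fraction) reads
      2 A/T = (1 + z) sum_r weight T A r / ((z - r) (z - 1/r)),
    and the left side is -2 at z.  For nonreal z the two sides, multiplied by
    z/(1 + z), have imaginary parts of opposite signs
    (nonreal_partial_fraction).  For real z < 1/t the right side is nonnegative.
    For 1/t <= z <= 1 the weights do not suffice, but there T <= 0 (salem_factor),
    hence S > 0. *)

(** * Polynomials and their reversals *)

(** The point 0 is left out because the functional equation of the reversal
    (recipE) only holds away from it. *)
Lemma poly_eq_off0 (F : numDomainType) (p q : {poly F}) :
  (forall x, x != 0 -> p.[x] = q.[x]) -> p = q.
Proof.
move=> pq; apply/eqP; rewrite -subr_eq0; apply/eqP.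
pose rs : seq F := [seq i%:R | i <- iota 1 (size (p - q))].
apply: (@roots_geq_poly_eq0 _ _ rs).
- apply/allP => _ /mapP[i i_in ->]; rewrite rootE !hornerE pq ?subrr //.
  by rewrite pnatr_eq0; move: i_in; rewrite mem_iota; case: i.
- by rewrite map_inj_uniq ?iota_uniq //; apply: mulrIn; rewrite oner_eq0.
- by rewrite size_map size_iota.
Qed.

Lemma invC_unit_circle (C : numClosedFieldType) (z : C) : `|z| = 1 -> z^-1 = z^*.
Proof.
move=> z1; have z0 : z != 0 by rewrite -normr_eq0 z1 oner_eq0.
by apply: (mulfI z0); rewrite divff // -normCK z1 expr1n.
Qed.

Lemma recip_map (A B : nzRingType) (f : {rmorphism A -> B}) (p : {poly A}) :
  injective f -> recip (map_poly f p) = map_poly f (recip p).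
Proof.
move=> f_inj; rewrite /recip size_map_inj_poly ?rmorph0 //.
apply/polyP => i; rewrite [RHS]coef_map 2!coef_poly coef_map /=.
by case: ifP; rewrite ?rmorph0.
Qed.

Lemma recip_prod_XsubC (F : numFieldType) (s : seq F) :
  recip (\prod_(a <- s) ('X - a%:P)) = \prod_(a <- s) (1 - a *: 'X).
Proof.
apply: poly_eq_off0 => x x0; rewrite recipE // size_prod_XsubC /= !horner_prod.
elim: s => [|a s IHs]; first by rewrite !big_nil mulr1.
rewrite !big_cons exprS mulrACA -IHs !hornerE.
by rewrite mulrBr divff // [x * a]mulrC.
Qed.

Lemma recip_oplus (A : nzRingType) (T P Q : {poly A}) :
  size P = size T -> size Q = size T ->
  size (P + Q - T) = size T -> recip (P + Q - T) = recip P + recip Q - recip T.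
Proof.
move=> sP sQ sS; apply/polyP => i.
rewrite !(coefD, coefN) !coef_poly sS sP sQ !(coefD, coefN).
by case: ifP => _; rewrite ?addr0 ?subr0.
Qed.

Lemma size_monicB (A : nzRingType) (p q : {poly A}) : p \is monic -> q \is monic ->
  size p = size q -> (size (p - q)%R < size q)%N.
Proof.
move=> /monicP p_mon q_mon pq.
have q0 : (0 < size q)%N by rewrite size_poly_gt0 monic_neq0.
rewrite -(prednK q0) ltnS; apply/leq_sizeP => i.
rewrite leq_eqVlt coefB => /predU1P[<-|].
  by rewrite -{1}pq -!/(lead_coef _) p_mon (monicP q_mon) subrr.
by rewrite prednK // => qi; rewrite !nth_default ?subrr ?pq.
Qed.

Lemma monic_oplus (A : nzRingType) (T P Q : {poly A}) : P \is monic -> Q \is monic ->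
  T \is monic -> size P = size T -> size Q = size T ->
  P + Q - T \is monic /\ size (P + Q - T) = size T.
Proof.
move=> P_mon Q_mon T_mon sP sQ; rewrite -addrA.
have sQT : (size (Q - T)%R < size P)%N by rewrite sP size_monicB.
by rewrite monicE lead_coefDl // size_polyDl // sP; split.
Qed.

Lemma uniq_roots_prod (F : fieldType) (rs : seq F) (T : {poly F}) :
  T = \prod_(r <- rs) ('X - r%:P) ->
  {in rs, forall r, T^`().[r] != 0} -> uniq rs.
Proof.
move=> ->; elim: rs => //= a s IHs; rewrite big_cons; set L := \prod_(r <- s) _.
have dL r : ((('X - a%:P) * L)^`()).[r] = L.[r] + (r - a) * L^`().[r].
  by rewrite !derivE !hornerE subr0 mul1r.
move=> sP; apply/andP; split.
  have := sP a (mem_head _ _); rewrite dL subrr mul0r addr0.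
  by rewrite -/(root L a) root_prod_XsubC.
apply: IHs => r r_in; have := sP r; rewrite inE r_in orbT => /(_ isT).
rewrite dL; have /eqP -> : root L r by rewrite root_prod_XsubC.
by rewrite add0r mulf_eq0 negb_or => /andP[].
Qed.

Lemma simple_root_deriv (F : fieldType) (p : {poly F}) (x : F) :
  p != 0 -> root p x -> mup x p = 1%N -> p^`().[x] != 0.
Proof.
move=> p0 /factor_theorem[q pE] px; apply/negP => /eqP.
rewrite pE !derivE !hornerE subrr mulr0 add0r /= => /eqP/factor_theorem[r qE].
have : (1 < mup x p)%N.
  by rewrite mup_geq // pE qE -mulrA -expr2 dvdp_mull.
by rewrite px.
Qed.

Lemma noroot_horner_gt0 (R : rcfType) (p : {poly R}) (c : R) :
  0 <= c -> 0 < p.[0] -> (forall x, 0 <= x <= c -> ~~ root p x) ->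
  forall x, 0 <= x <= c -> 0 < p.[x].
Proof.
move=> c0 p0 pN x /andP[x0 xc]; rewrite ltNge; apply/negP => px.
have [||y] := @polyrcf.poly_ivt R p 0 x => //.
  by rewrite mulr_ge0_le0 // ltW.
rewrite in_itv /= => /andP[y0 yx] py.
by move: (pN y); rewrite y0 (le_trans yx xc) py => /(_ isT).
Qed.

(** * The kernel of a polynomial with no zero in the closed unit disc *)

(** The second product is the reversal of the conjugate of the first, so this is
    the positivity of the Schur-Cohn form.  It follows one linear factor at a time
    from
      (z - a) (w' - a') - (1 - a' z) (1 - a w') = (|a|^2 - 1) (1 - z w'),
    where the prime is complex conjugation, and |a| > 1 makes the first factor on the
    right positive. *)
Lemma schur_kernel (C : numClosedFieldType) (s : seq C) :
  all (fun a => 1 < `|a|) s ->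
  exists gs : seq {poly C}, forall z w : C,
    (\prod_(a <- s) ('X - a%:P)).[z] * ((\prod_(a <- s) ('X - a%:P)).[w])^*
    - (\prod_(a <- s) (1 - a^* *: 'X)).[z]
      * ((\prod_(a <- s) (1 - a^* *: 'X)).[w])^*
    = (1 - z * w^*) * \sum_(g <- gs) g.[z] * (g.[w])^*.
Proof.
elim: s => [_|a s IHs /= /andP[a_gt1 /IHs[gs gsE]]].
  exists [::] => z w.
  by rewrite !big_nil !hornerE rmorph1 subrr.
set p := \prod_(a <- s) _ in gsE; set q := \prod_(a <- s) _ in gsE.
exists ((sqrtC (a * a^* - 1) *: p) :: [seq (1 - a^* *: 'X) * g | g <- gs]) => z w.
rewrite !big_cons big_map -/p -/q !hornerE /=.
under eq_bigr do rewrite !hornerE /= rmorphM /= mulrACA.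
rewrite -mulr_sumr !rmorphM /= !rmorphB rmorph1 rmorphM /= conjCK.
set t := sqrtC _.
have tt : t * t^* = a * a^* - 1.
  rewrite (CrealP _) ?ger0_real ?sqrtC_ge0 -?expr2 ?sqrtCK //.
  by rewrite -normCK subr_ge0 exprn_ege1 // ltW.
have := gsE z w; set K := \sum_(g <- gs) _ => KE.
rewrite mulrDr [(1 - z * w^*) * (_ * K)]mulrCA -KE.
rewrite [t * _ * _]mulrACA tt; ring.
Qed.

(** A boundary Schwarz lemma.  With P = T + A and Q = T + X A, the map Q/P fixes
    the roots z and b of T.  If K is the kernel of schur_kernel, then
    K(u, b) = A(u) A(b)^* for u = z, b, while K(z, z) exceeds |A(z)|^2 by exactly
    the quantity to be bounded.  The vector equal to 1 at z and to - A(z)/A(b) at b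
    is orthogonal to A, so on it K takes that quantity as its value, and K is a sum
    of squares. *)
Lemma kernel_two_point (C : numClosedFieldType) (s : seq C) (T A : {poly C}) z b:
  all (fun a => 1 < `|a|) s ->
  T + A = \prod_(a <- s) ('X - a%:P) ->
  T + 'X * A = \prod_(a <- s) (1 - a^* *: 'X) ->
  `|z| = 1 -> `|b| != 1 -> root T z -> root T b -> A.[b] != 0 ->
  0 <= (1 - z) * T^`().[z] * (A.[z])^*.
Proof.
move=> s_gt1 PE QE z1 b1 /eqP Tz /eqP Tb Ab.
have [gs gsE] := schur_kernel s_gt1.
rewrite -PE -QE in gsE.
pose K u v := \sum_(g <- gs) g.[u] * (g.[v])^*.
have zz : z * z^* = 1 by rewrite -normCK z1 expr1n.
have z0 : z != 0 by rewrite -normr_eq0 z1 oner_eq0.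
have KC u v : K v u = (K u v)^*.
  rewrite rmorph_sum; apply: eq_bigr => g _.
  by rewrite rmorphM /= conjCK mulrC.
have Kb u : root T u -> u * b^* != 1 -> K u b = A.[u] * (A.[b])^*.
  move=> /eqP Tu ub1; apply: (@mulfI _ (1 - u * b^*)).
    by rewrite subr_eq0 eq_sym.
  rewrite /K -gsE !hornerE Tu Tb /= !add0r rmorphM; ring.
have bb1 : b * b^* != 1.
  rewrite -normCK -[X in _ != X](expr1n _ 2) eqrXn2 //.
have zb1 : z * b^* != 1.
  apply: contra b1 => /eqP zb; rewrite -norm_conjC.
  by rewrite -[X in _ == X](normr1 C) -zb normrM z1 mul1r.
have Kzz : K z z = A.[z] * (A.[z])^* + (1 - z) * T^`().[z] * (A.[z])^*.
  (* 1 - z z^* vanishes, so the diagonal value is reached by differentiating the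
     kernel identity in its first variable. *)
  have dE : ((A.[z])^* *: (T + A) - (z * A.[z])^* *: (T + 'X * A))
      = (1 - z^* *: 'X) * \sum_(g <- gs) (g.[z])^* *: g.
    apply: poly_eq_off0 => u _; rewrite !hornerE horner_sum.
    have := gsE u z; rewrite !hornerE Tz !add0r [_ * u]mulrC => ue.
    under eq_bigr do rewrite hornerE mulrC.
    by rewrite -ue; ring.
  have Kz : (\sum_(g <- gs) (g.[z])^* *: g).[z] = K z z.
    by rewrite horner_sum; apply: eq_bigr => g _; rewrite hornerE mulrC.
  have := congr1 (fun p => p^`().[z]) dE.
  have zV : z^* = z^-1 by rewrite invC_unit_circle.
  rewrite !derivE !hornerE /= Kz rmorphM /= zV mulVf // subrr mul0r addr0 => dK.
  have zVN : - z^-1 != 0 by rewrite oppr_eq0 invr_eq0.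
  by apply: (mulfI zVN); rewrite -dK; field.
pose k := A.[z] / A.[b].
suff -> : (1 - z) * T^`().[z] * (A.[z])^* =
    \sum_(g <- gs) `|g.[z] - k * g.[b]| ^+ 2.
  by apply: sumr_ge0 => g _; rewrite exprn_ge0.
transitivity (K z z - k^* * K z b - k * K b z + k * k^* * K b b).
  rewrite (KC z b) !Kb //; try exact/eqP.
  rewrite Kzz /k !rmorphM fmorphV /= conjCK.
  have Abc : (A.[b])^* != 0 by rewrite conjC_eq0.
  by field; rewrite Ab Abc.
clearbody k; rewrite /K !mulr_sumr -!sumrB -big_split; apply: eq_bigr => g _ /=.
rewrite normCK rmorphB !rmorphM /=; ring.
Qed.

(** * Partial fractions of self-reciprocal quotients *)

Lemma partial_fraction (F : fieldType) (rs : seq F) (A T : {poly F}) (z : F) :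
  T = \prod_(r <- rs) ('X - r%:P) -> uniq rs -> (size A <= size rs)%N ->
  T.[z] != 0 ->
  A.[z] / T.[z] = \sum_(r <- rs) A.[r] / T^`().[r] / (z - r).
Proof.
move=> TE rs_uniq sA Tz.
pose L r := \prod_(s <- rem r rs) ('X - s%:P).
have TL r : r \in rs -> T = ('X - r%:P) * L r.
  by move=> r_in; rewrite TE (perm_big _ (perm_to_rem r_in)) big_cons.
have dT r : r \in rs -> T^`().[r] = (L r).[r].
  by move=> /TL ->; rewrite !derivE !hornerE subrr mul0r addr0 /=.
have L0 r : r \in rs -> (L r).[r] != 0.
  move=> r_in; rewrite -/(root _ r) root_prod_XsubC.
  by rewrite mem_rem_uniq // inE /= eqxx.
have AE : A = \sum_(r <- rs) (A.[r] / T^`().[r]) *: L r.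
  apply/eqP; rewrite -subr_eq0; apply/eqP.
  apply: (@roots_geq_poly_eq0 _ _ rs) => //.
    apply/allP => r r_in; rewrite rootE !hornerE horner_sum.
    rewrite (bigD1_seq r) //= hornerE dT // divfK ?L0 //.
    rewrite big_seq_cond big1 ?addr0 ?subrr // => s /andP[s_in sr].
    suff /eqP Ls0 : root (L s) r by rewrite hornerE Ls0 mulr0.
    by rewrite root_prod_XsubC mem_rem_uniq // inE /= eq_sym sr.
  rewrite (leq_trans (size_polyD _ _)) // geq_max sA size_polyN.
  apply: (leq_trans (size_sum _ _ _)); apply/bigmax_leqP_seq => r r_in _.
  apply: (leq_trans (size_scale_leq _ _)).
  by rewrite size_prod_XsubC size_rem // prednK // -has_predT; apply/hasP; exists r.
rewrite {1}AE horner_sum mulr_suml; apply: eq_big_seq => r r_in.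
rewrite hornerE -!mulrA; do 2!congr (_ * _).
move: Tz; rewrite (TL r) // !hornerE /= mulf_eq0 negb_or => /andP[zr Lz].
by rewrite invfM mulrC mulfVK.
Qed.

(** The residue of V/U at x = r + 1/r, where x = z + 1/z and
    A/T = (1 + 1/z) V(x)/U(x). *)
Definition weight (F : fieldType) (T A : {poly F}) (r : F) : F :=
  (1 - r^-1) * A.[r] / T^`().[r].

(** On the unit circle the weight is the quantity of kernel_two_point divided by
    |T'(z)|^2; it is nonzero because z <> 1 and a common root of T and A would
    be a root of P in the closed disc. *)
Lemma weight_unit_circle (C : numClosedFieldType) (P T A : {poly C}) (z b : C) :
  P \is monic -> map_poly Num.conj P = P -> (forall x, root P x -> 1 < `|x|) ->
  P = T + A -> recip P = T + 'X * A ->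
  `|z| = 1 -> z != 1 -> root T z -> T^`().[z] != 0 ->
  `|b| < 1 -> root T b ->
  0 < weight T A z.
Proof.
move=> P_mon P_real P_exp PE QE z1 zN1 Tz dTz b1 Tb.
have [s] := closed_field_poly_normal P.
rewrite (monicP P_mon) scale1r => Ps.
have s_gt1 : all (fun a => 1 < `|a|) s.
  by apply/allP => a a_in; apply: P_exp; rewrite Ps root_prod_XsubC.
have Qs : recip P = \prod_(a <- s) (1 - a^* *: 'X).
  rewrite -P_real Ps rmorph_prod -(big_map Num.conj xpredT (fun a => 1 - a *: 'X)).
  rewrite -recip_prod_XsubC big_map; congr recip; apply: eq_bigr => a _.
  by rewrite rmorphB /= map_polyX map_polyC.
have A0 x : root T x -> `|x| <= 1 -> A.[x] != 0.
  move=> /eqP Tx x1; apply/eqP => Ax.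
  have : root P x by rewrite rootE PE hornerD Tx Ax addr0.
  by move/P_exp; rewrite le_gtF.
have D_ge0 : 0 <= (1 - z) * T^`().[z] * (A.[z])^*.
  apply: (kernel_two_point s_gt1 _ _ z1 _ Tz Tb); rewrite -?PE -?QE //.
    by rewrite lt_eqF.
  by rewrite A0 // ltW.
have z0 : z != 0 by rewrite -normr_eq0 z1 oner_eq0.
have zV : z^* = z^-1 by rewrite invC_unit_circle.
have wE : weight T A z = (1 - z) * T^`().[z] * (A.[z])^* / `|T^`().[z]| ^+ 2.
  rewrite -(CrealP (ger0_real D_ge0)) !rmorphM rmorphB rmorph1 /= conjCK zV normCK.
  by rewrite /weight; field; rewrite dTz conjC_eq0 dTz z0.
rewrite lt_def; apply/andP; split.
  rewrite /weight !mulf_neq0 ?invr_eq0 ?A0 ?z1 //.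
  by rewrite subr_eq0 eq_sym invr_eq1.
by rewrite wE mulr_ge0 // invr_ge0 exprn_ge0.
Qed.

(** The symmetry hypotheses give A(z)/T(z) = (1/z) A(1/z)/T(1/z).  Averaging the
    partial fractions of the two sides pairs 1/(z - r) with 1/(1 - z r), whose sum
    is (1 + z) (1 - r) / ((z - r) (1 - z r)). *)
Lemma symmetric_partial_fraction (F : fieldType) (rs : seq F) (A T : {poly F})
    (n : nat) (z : F) :
  T = \prod_(r <- rs) ('X - r%:P) -> uniq rs -> (size A <= size rs)%N ->
  0 \notin rs -> z != 0 -> T.[z] != 0 ->
  z ^+ n * T.[z^-1] = T.[z] -> z ^+ n * A.[z^-1] = z * A.[z] ->
  2 * (A.[z] / T.[z])
    = (1 + z) * \sum_(r <- rs) weight T A r / ((z - r) * (z - r^-1)).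
Proof.
move=> TE rs_uniq sA rs0 z0 Tz Tsym Asym.
have TVz : T.[z^-1] != 0 by apply: contraNneq Tz => Tz; rewrite -Tsym Tz mulr0.
have AT : A.[z] / T.[z] = z^-1 * (A.[z^-1] / T.[z^-1]).
  rewrite -Tsym invfM [RHS]mulrA -[A.[z]](mulKf z0) -Asym.
  by field; rewrite TVz expf_neq0 z0.
rewrite -[2]/(1 + 1) mulrDl mul1r {2}AT !(partial_fraction TE) //.
rewrite !mulr_sumr -big_split; apply: eq_big_seq => r r_in /=.
have r0 : r != 0 by apply: contraNneq rs0 => <-.
have zr u : T.[u] != 0 -> u - r != 0.
  move=> Tu; rewrite subr_eq0; apply: contraNneq Tu => ->.
  by rewrite -/(root T r) TE root_prod_XsubC.
have zr1 := zr _ Tz; have zr2 := zr _ TVz.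
have e1 : z^-1 - r = (1 - z * r) / z by rewrite mulrBl mul1r mulrAC divff ?mul1r.
have e2 : z - r^-1 = - (1 - z * r) / r.
  by rewrite opprB mulrBl mul1r mulfK.
have zr3 : 1 - z * r != 0 by apply: contraNneq zr2; rewrite e1 => ->; rewrite mul0r.
rewrite /weight e1 e2; set d := (T^`().[r])^-1.
by field; rewrite r0 z0 zr1 oppr_eq0 zr3.
Qed.

Lemma ImV (C : numClosedFieldType) (w : C) : 'Im (w^-1) = - (`|w| ^- 2 * 'Im w).
Proof.
by rewrite invC_norm ImMl ?Im_conj ?mulrN // rpredV rpredX // normr_real.
Qed.

(** Up to the factor z, the denominators are w = z + 1/z - (r + 1/r), and
    Im w = (1 - |z|^-2) Im z.  Multiplying the sum by z therefore gives an imaginary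
    part that is zero or has the sign of Im z, whereas - 2 z/(1 + z) has an imaginary
    part of the opposite sign. *)
Lemma nonreal_partial_fraction (C : numClosedFieldType) (rs : seq C) (c : C -> C)
    (z : C) :
  z \isn't Num.real -> `|z| <= 1 ->
  {in rs, forall r, [/\ r != 0, r + r^-1 \is Num.real & 0 <= c r]} ->
  {in rs, forall r, z != r} -> {in rs, forall r, z != r^-1} ->
  (1 + z) * \sum_(r <- rs) c r / ((z - r) * (z - r^-1)) != - 2.
Proof.
move=> z_nreal z_le1 rsP zr1 zr2; apply/eqP => E.
have z0 : z != 0 by apply: contraNneq z_nreal => ->; apply: rpred0.
have z10 : 1 + z != 0.
  apply: contraNneq z_nreal => /eqP; rewrite addrC addr_eq0 => /eqP ->.
  by rewrite rpredN rpred1.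
have Imz0 : 'Im z != 0 by apply: contraNneq z_nreal => /Creal_ImP.
have ImzV : 'Im (z + z^-1) = - ((`|z| ^- 2 - 1) * 'Im z).
  by rewrite raddfD /= ImV mulrBl opprB mul1r addrC.
pose w r := z + z^-1 - (r + r^-1).
have wE r : r \in rs -> c r / ((z - r) * (z - r^-1)) = z^-1 * (c r * (w r)^-1).
  move=> r_in; have [r0 _ _] := rsP r r_in.
  have -> : w r = (z - r) * (z - r^-1) / z by rewrite /w; field; rewrite r0 z0.
  field; rewrite z0 r0 !subr_eq0 zr1 // andbT /=.
  by apply: contraNneq (zr2 r r_in) => zr; rewrite -[z](mulfK r0) zr mul1r.
have : 2 * 'Im ((1 + z)^-1) = \sum_(r <- rs) c r * 'Im ((w r)^-1).
  transitivity ('Im (z * \sum_(r <- rs) c r / ((z - r) * (z - r^-1)))).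
    have -> : z * \sum_(r <- rs) c r / ((z - r) * (z - r^-1)) = 2 * (1 + z)^-1 - 2.
      by apply: (mulfI z10); rewrite mulrCA E; field.
    rewrite raddfB /= ImMl ?rpredMn ?rpred1 //.
    by rewrite (Creal_ImP 2 _) ?subr0 // rpredMn // rpred1.
  rewrite mulr_sumr raddf_sum /=; apply: eq_big_seq => r r_in.
  have [_ _ cr] := rsP r r_in.
  by rewrite wE // mulVKf // ImMl // ger0_real.
rewrite ImV raddfD /= (Creal_ImP 1 _) ?rpred1 // add0r.
have -> : \sum_(r <- rs) c r * 'Im ((w r)^-1)
    = (\sum_(r <- rs) c r * (`|w r| ^- 2 * (`|z| ^- 2 - 1))) * 'Im z.
  rewrite mulr_suml; apply: eq_big_seq => r r_in; have [_ xr _] := rsP r r_in.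
  rewrite ImV /w raddfB /= (Creal_ImP _ xr) subr0 ImzV; ring.
rewrite mulrN mulrA -mulNr => /(mulIf Imz0).
apply/eqP; rewrite lt_eqF //.
apply: (@lt_le_trans _ _ 0).
  by rewrite oppr_lt0 mulr_gt0 ?invr_gt0 ?exprn_gt0 ?normr_gt0.
rewrite big_seq sumr_ge0 // => r r_in; have [_ _ cr] := rsP r r_in.
rewrite !mulr_ge0 ?invr_ge0 ?exprn_ge0 // subr_ge0.
by rewrite invf_ge1 ?exprn_gt0 ?normr_gt0 // exprn_ile1.
Qed.

(** * Integer polynomials over the real and complex numbers *)

Section RealEmbedding.
Variable R : realType.
Local Notation C := R[i].
Local Notation toR p := (map_poly (intr : int -> R) p).
Local Notation toC p := (map_poly (intr : int -> C) p).
Local Notation rc := (real_complex R).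

Lemma map_real_complex_int (p : {poly int}) : map_poly rc (toR p) = toC p.
Proof.
by rewrite -map_poly_comp; apply: eq_map_poly => i /=; rewrite rmorph_int.
Qed.

Lemma horner_real_complex_int (p : {poly int}) (x : R) :
  (toC p).[rc x] = rc (toR p).[x].
Proof. by rewrite -map_real_complex_int horner_map. Qed.

Lemma root_real_complex_int (p : {poly int}) (x : R) :
  root (toC p) (rc x) = root (toR p) x.
Proof. by rewrite !rootE horner_real_complex_int fmorph_eq0. Qed.

Lemma conj_int_poly (p : {poly int}) : map_poly Num.conj (toC p) = toC p.
Proof.
by rewrite -map_poly_comp; apply: eq_map_poly => i /=; rewrite rmorph_int.
Qed.

Lemma size_toC (p : {poly int}) : size (toC p) = size p.
Proof. by rewrite size_map_inj_poly //; exact: intr_inj. Qed.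

Lemma toC_int (p : {poly int}) (k : int) : (toC p).[k%:~R] = (p.[k])%:~R.
Proof. by rewrite horner_map. Qed.

End RealEmbedding.

(** * The cone of expansive polynomials over a Salem polynomial *)

Section SalemCone.
Variables (R : realType) (T : {poly int}).
Local Notation C := R[i].
Local Notation toR p := (map_poly (intr : int -> R) p).
Local Notation toC p := (map_poly (intr : int -> C) p).
Local Notation rc := (real_complex R).
Hypotheses (T_monic : T \is monic) (T_rec : reciprocal T).
Hypotheses (T_simple : simple_roots R T) (T1 : T.[1] != 0).
Variable t : R.
Hypotheses (t_gt1 : 1 < t) (Tt : root (toC T) (rc t)).
Hypothesis t_only : forall z : C, root (toC T) z -> 1 < `|z| -> z = rc t.

Let m := (size T).-1.

Lemma T0_eq1 : T.[0] = 1.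
Proof.
rewrite horner_coef0 -{1}T_rec coef_poly subn0 size_poly_gt0.
by rewrite monic_neq0 //; exact/eqP/T_monic.
Qed.

Lemma TC_neq0 : toC T != 0.
Proof. by rewrite monic_neq0 // monic_map. Qed.

Lemma TC_rec (z : C) : z != 0 -> z ^+ m * (toC T).[z^-1] = (toC T).[z].
Proof.
move=> z0; rewrite -{2}T_rec -recip_map; last exact: intr_inj.
by rewrite recipE // size_toC.
Qed.

Lemma TC_deriv (z : C) : root (toC T) z -> (toC T)^`().[z] != 0.
Proof.
move=> Tz; apply: simple_root_deriv => //; first exact: TC_neq0.
exact: T_simple.
Qed.

Lemma TC_root0 : ~~ root (toC T) 0.
Proof. by rewrite rootE -[0]/(0%:~R) toC_int T0_eq1 oner_eq0. Qed.

Lemma TC_rootV (z : C) : root (toC T) z -> root (toC T) z^-1.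
Proof.
move=> Tz; have z0 : z != 0 by apply: contraTneq Tz => ->; exact: TC_root0.
by move: Tz; rewrite !rootE -TC_rec // mulf_eq0 expf_eq0 (negPf z0) andbF.
Qed.

(** Roots inside the disc are inverses of roots outside, of which there is only
    one. *)
Lemma TC_root_cases (z : C) : root (toC T) z ->
  [\/ `|z| = 1, z = rc t | z = rc t^-1].
Proof.
move=> Tz; have z0 : z != 0 by apply: contraTneq Tz => ->; exact: TC_root0.
have [z1|z1|z1] := real_ltgtP (normr_real z) (@real1 C).
- apply: Or33; rewrite fmorphV /= -(t_only (TC_rootV Tz)) ?invrK //.
  by rewrite normfV invf_gt1 // normr_gt0.
- by apply: Or32; exact: t_only.
- exact: Or31.
Qed.

(** This determines the sign of T on [0, t] and the signs of T' at t and 1/t.  The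
    cofactor has no root in [0, t], because the roots of T are simple, T(1) <> 0, and
    no other root of T is positive. *)
Lemma salem_factor : exists W : {poly R},
  toR T = ('X - t^-1%:P) * ('X - t%:P) * W /\
  forall x, 0 <= x <= t -> 0 < W.[x].
Proof.
have t0 : 0 < t by apply: lt_trans t_gt1.
have := Tt; rewrite root_real_complex_int => /factor_theorem[V VE].
have := TC_rootV Tt; rewrite -fmorphV root_real_complex_int rootE {1}VE.
rewrite !hornerE mulf_eq0 subr_eq0 => /orP[/factor_theorem[W WE]|/eqP tt]; last first.
  by move: t_gt1; rewrite -invf_lt1 // tt ltNge ltW.
have TE : toR T = ('X - t^-1%:P) * ('X - t%:P) * W by rewrite VE WE; ring.
have TRt : (toR T).[0] = 1 by rewrite -[0]/(0%:~R) horner_map T0_eq1.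
exists W; split => //.
apply: noroot_horner_gt0; first exact: ltW.
  have : (toR T).[0] = W.[0] by rewrite TE !hornerE mulrNN mulVf ?mul1r // gt_eqF.
  by rewrite TRt => <-.
have dT x : root (toR T) x -> (toR T)^`().[x] != 0.
  rewrite -root_real_complex_int => /TC_deriv.
  by rewrite -map_real_complex_int deriv_map horner_map fmorph_eq0.
move=> x /andP[x0 xt]; apply/negP => Wx.
have Tx : root (toR T) x by rewrite TE rootM Wx orbT.
have : root (toC T) (rc x) by rewrite root_real_complex_int.
move=> /TC_root_cases[x1|/complexI x1|/complexI x1].
- move: x1; rewrite ger0_norm ?ler0c // => /complexI x1.
  move: Tx; rewrite x1 rootE -[1]/(1%:~R) horner_map intr_eq0.
  by rewrite (negPf T1).
- move: (dT x Tx); rewrite TE !derivE !hornerE x1 subrr (eqP (_ : root W t)) -?x1 //.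
  by rewrite !(mulr0, mul0r, addr0) eqxx.
- move: (dT x Tx); rewrite TE !derivE !hornerE x1 subrr (eqP (_ : root W t^-1)) -?x1 //.
  by rewrite !(mulr0, mul0r, addr0) eqxx.
Qed.

Section Member.
Variable P : {poly int}.
Hypothesis P_in : Pplus R T P.
Local Notation A := (toC P - toC T).

Lemma member_spec : [/\ P \is monic, forall z : C, root (toC P) z -> 1 < `|z|,
  size P = size T, poly_over T P & 2 <= P.[0]].
Proof.
case: P_in => q /= q2 [P_mon [_ P_exp] sP PT P0]; split => //; last by rewrite P0.
by move=> z; rewrite -map_real_complex_int; apply: P_exp.
Qed.

Lemma recip_member : recip (toC P) = toC T + 'X * A.
Proof.
have [_ _ _ PT _] := member_spec.
rewrite recip_map; last exact: intr_inj.
have -> : recip P = T + 'X * (P - T).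
  by rewrite -[recip P](subKr ('X * P)) -PT; ring.
by rewrite rmorphD rmorphM rmorphB /= map_polyX.
Qed.

(** The palindromic symmetry of A, obtained by evaluating P^* in two ways. *)
Lemma member_sym (z : C) : z != 0 -> z ^+ m * A.[z^-1] = z * A.[z].
Proof.
move=> z0; have [_ _ sP _ _] := member_spec.
have := congr1 (fun p => p.[z]) recip_member.
rewrite recipE // size_toC sP -/m !hornerE -{1}(TC_rec z0) mulrBr => E.
by rewrite mulrBr E; ring.
Qed.

Lemma member_gt0 (x : R) : 0 <= x <= 1 -> 0 < (toR P).[x].
Proof.
have [_ P_exp _ _ P0] := member_spec.
apply: noroot_horner_gt0 => //.
  by rewrite -[0 in X in _ < X]/(0%:~R) horner_map ltr0z (lt_le_trans _ P0).
move=> {}x /andP[x0 x1]; apply/negP; rewrite -root_real_complex_int => /P_exp.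
by rewrite ger0_norm ?ler0c // ltcR ltNge x1.
Qed.

(** At the two real roots, A(1/t) = P(1/t) > 0, the sign of A(t) follows by
    symmetry, and those of T' come from salem_factor. *)
Lemma member_weight_gt0 (z : C) : root (toC T) z -> 0 < weight (toC T) A z.
Proof.
move=> Tz; have [P_mon P_exp _ _ _] := member_spec.
have t0 : 0 < t by apply: lt_trans t_gt1.
have tV1 : t^-1 < 1 by rewrite invf_lt1.
have tV0 : 0 < t^-1 by rewrite invr_gt0.
have [W [TE W_gt0]] := salem_factor.
have wR (x : R) : weight (toC T) A (rc x) = rc (weight (toR T) (toR P - toR T) x).
  rewrite /weight -!map_real_complex_int -rmorphB /= deriv_map !horner_map.
  by rewrite !(rmorphM, rmorphB, rmorph1, fmorphV).
have TR0 (x : R) : root (toC T) (rc x) -> (toR T).[x] = 0.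
  by rewrite root_real_complex_int => /eqP.
have AtV : 0 < (toR P - toR T).[t^-1].
  rewrite hornerD hornerN TR0 ?subr0 ?fmorphV ?TC_rootV //.
  by rewrite member_gt0 // !ltW.
have At : 0 < (toR P - toR T).[t].
  have := @member_sym (rc t); rewrite -fmorphV -!map_real_complex_int -rmorphB /=.
  rewrite !horner_map -rmorphXn -!rmorphM fmorph_eq0 gt_eqF // => /(_ isT)/complexI.
  by rewrite -(pmulr_rgt0 _ t0) => <-; rewrite pmulr_rgt0 // exprn_gt0.
have dTE x : (toR T)^`().[x] = (x - t) * W.[x] + (x - t^-1) * W.[x]
    + (x - t^-1) * (x - t) * W^`().[x].
  by rewrite TE !derivE !hornerE /=; ring.
have [z1|zt|zt] := TC_root_cases Tz.
- apply: (@weight_unit_circle _ (toC P) _ _ _ (rc t^-1)) => //.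
  + by rewrite monic_map.
  + exact: conj_int_poly.
  + by rewrite addrC subrK.
  + exact: recip_member.
  + apply: contraNneq T1 => z1'; move: Tz; rewrite z1' rootE -[1]/(1%:~R) toC_int.
    by rewrite intr_eq0.
  + exact: TC_deriv.
  + by rewrite ger0_norm ?ler0c ?ltcR // ltW.
  + by rewrite fmorphV TC_rootV.
- rewrite zt wR ltcR /weight; apply: divr_gt0.
    by rewrite mulr_gt0 // subr_gt0.
  rewrite dTE subrr !(mul0r, mulr0, add0r, addr0) mulr_gt0 //.
    by rewrite subr_gt0 (lt_trans tV1).
  by rewrite W_gt0 // ltW //= lexx.
- rewrite zt wR ltcR /weight invrK -mulrNN -invrN; apply: divr_gt0.
    by rewrite -mulNr opprB mulr_gt0 // subr_gt0.
  rewrite dTE subrr !(mul0r, mulr0, addr0) -mulNr opprB mulr_gt0 //.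
    by rewrite subr_gt0 (lt_trans tV1).
  by rewrite W_gt0 // ltW //= ltW // (lt_trans tV1).
Qed.

End Member.

(** The weights are additive in A, so those of P + Q - T are positive; the zeros of
    P + Q - T in the closed disc are then excluded one region at a time. *)
Lemma oplus_no_root (P Q : {poly int}) (z : C) : Pplus R T P -> Pplus R T Q ->
  root (toC (P + Q - T)) z -> 1 < `|z|.
Proof.
move=> P_in Q_in Sz; rewrite real_ltNge ?normr_real ?real1 //; apply/negP => z1.
have [_ _ sP _ P0] := member_spec P_in; have [_ _ sQ _ Q0] := member_spec Q_in.
have [P_mon _ _ _ _] := member_spec P_in; have [Q_mon _ _ _ _] := member_spec Q_in.
pose A := (toC P - toC T) + (toC Q - toC T).
have SE : toC (P + Q - T) = toC T + A by rewrite !rmorphB rmorphD /= /A; ring.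
have w_gt0 r : root (toC T) r -> 0 < weight (toC T) A r.
  move=> Tr; rewrite /weight /A hornerD mulrDr mulrDl.
  by rewrite addr_gt0 // member_weight_gt0.
have A_sym u : u != 0 -> u ^+ m * A.[u^-1] = u * A.[u].
  by move=> u0; rewrite !(hornerD (toC P - _)) !mulrDr !member_sym.
have [rs] := closed_field_poly_normal (toC T).
rewrite (monicP _) ?monic_map // scale1r => TE.
have rsT r : r \in rs -> root (toC T) r by rewrite TE root_prod_XsubC.
have rs_uniq : uniq rs.
  by apply: (uniq_roots_prod TE) => r /rsT; exact: TC_deriv.
have sA : (size A <= size rs)%N.
  have s_rs : (size rs).+1 = size T by rewrite -(size_toC R) TE size_prod_XsubC.
  have sB p : p \is monic -> size p = size T -> (size (toC p - toC T)%R <= size rs)%N.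
    move=> p_mon pT; rewrite -rmorphB size_toC -ltnS s_rs.
    exact: size_monicB.
  by rewrite (leq_trans (size_polyD _ _)) // geq_max !sB.
have rs0 : 0 \notin rs by apply/negP => /rsT; apply/negP/TC_root0.
have rs_nz r : r \in rs -> r != 0 by move=> r_in; apply: contraNneq rs0 => <-.
(* A common root of T and P + Q - T would be a root of A, hence have weight 0. *)
have Tz : (toC T).[z] != 0.
  apply/eqP => Tz0; have Tz : root (toC T) z by apply/eqP.
  move: Sz; rewrite SE rootE hornerD Tz0 add0r => /eqP Az.
  by have := w_gt0 z Tz; rewrite /weight Az mulr0 mul0r ltxx.
have z0 : z != 0.
  apply: contraTneq Sz => ->; rewrite rootE -[0]/(0%:~R) toC_int intr_eq0.
  by rewrite !hornerD hornerN T0_eq1 gt_eqF // subr_gt0 (lt_le_trans _ (lerD P0 Q0)).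
have := symmetric_partial_fraction TE rs_uniq sA rs0 z0 Tz (TC_rec z0) (A_sym z z0).
have Az : A.[z] / (toC T).[z] = -1.
  move: Sz; rewrite SE rootE hornerD addrC addr_eq0 => /eqP ->.
  by rewrite mulNr divff.
rewrite Az mulrN1 => /esym/eqP; apply/negP.
have [z_real|z_nreal] := boolP (z \is Num.real); last first.
  apply: nonreal_partial_fraction => // r r_in.
  - rewrite rs_nz // ltW ?w_gt0 ?rsT //; split => //.
    case: (TC_root_cases (rsT r r_in)) => [r1|->|->].
    + by rewrite invC_unit_circle // CrealE rmorphD /= conjCK addrC.
    + by rewrite -fmorphV -rmorphD /=; apply/complex_realP; eexists.
    + by rewrite -fmorphV -rmorphD /=; apply/complex_realP; eexists.
  - by apply: contraNneq Tz => ->; apply: rsT.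
  - by apply: contraNneq Tz => ->; apply/TC_rootV/rsT.
have [x zx] := complex_realP _ z_real.
have [W [WE W_gt0]] := salem_factor.
have tV1 : t^-1 < 1 by rewrite invf_lt1 // (lt_trans _ t_gt1).
have x1 : - 1 <= x <= 1.
  by move: z1; rewrite real_ler_norml // zx -(rmorphN1 rc) -(rmorph1 rc) !lecR.
(* T is nonpositive between its roots 1/t and t, while P and Q are positive on
   [0, 1]. *)
have [xt|tx] := ltP x t^-1; last first.
  have x0 : 0 <= x by rewrite (le_trans _ tx) // invr_ge0 ltW // (lt_trans _ t_gt1).
  have xle1 : x <= 1 by case/andP: x1.
  have TRx : (toR T).[x] <= 0.
    rewrite WE !hornerE /= mulr_le0_ge0 //.
      by rewrite mulr_ge0_le0 ?subr_ge0 // subr_le0 (le_trans xle1) // ltW.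
    by rewrite ltW // W_gt0 // x0 (le_trans xle1) // ltW.
  move: Sz; rewrite zx root_real_complex_int rootE rmorphB rmorphD /=.
  rewrite !hornerE gt_eqF //.
  by rewrite subr_gt0 (le_lt_trans TRx) // addr_gt0 // member_gt0 // x0.
(* Left of 1/t the factors z - r and z - 1/r are conjugate or both negative. *)
rewrite gt_eqF // (@lt_le_trans _ _ 0) // ?oppr_lt0 ?ltr0n //.
apply: mulr_ge0.
  by rewrite -lerBlDl sub0r zx -(rmorphN1 rc) lecR; case/andP: x1.
rewrite big_seq; apply: sumr_ge0 => r r_in.
apply: divr_ge0; first by rewrite ltW // w_gt0 // rsT.
have tt : 0 <= (x - t) * (x - t^-1).
  by rewrite mulr_le0 // subr_le0 ltW // (lt_trans xt) // (lt_trans tV1).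
case: (TC_root_cases (rsT r r_in)) => [r1|->|->].
- rewrite invC_unit_circle // -{2}(CrealP z_real) -rmorphB /= -normCK exprn_ge0 //.
- by rewrite zx -fmorphV -!rmorphB -rmorphM /= ler0c.
- by rewrite zx -fmorphV invrK -!rmorphB -rmorphM /= ler0c mulrC.
Qed.

End SalemCone.

Theorem theorem2p9 (R : realType) (m : nat) (T : {poly int}) (beta : R)
    (hm : (4 <= m)%N) (m_even : ~~ odd m)
    (T_deg : size T = m.+1) (T_salem : salem_polynomial R T)
    (beta_salem : salem_number beta) (T_beta : root (map_poly intr T) beta)
    (T_simple : simple_roots R T)
    (T1 : T.[1] != 0) (TN1 : T.[-1] != 0) :
  (forall (q q' : int) (P P' : {poly int}), 2 <= q -> 2 <= q' ->
     Eplus R T q P -> Eplus R T q' P' ->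
     let S := P + P' - T in
     [/\ S \is monic,
         expansive (map_poly intr S : {poly R}),
         size S = m.+1,
         poly_over T S
       & Eplus R T (q + q' - 1) S])
  /\ commutative_semigroup_on (Pplus R T `|` [set T]) (oplus T)
  /\ neutral_on (Pplus R T `|` [set T]) (oplus T) T.
Proof.
have [T_mon T_rec [t [t_gt1 Tt _ t_only]] _] := T_salem.
have oplus_Eplus q q' P P' : 2 <= q -> 2 <= q' ->
    Eplus R T q P -> Eplus R T q' P' -> Eplus R T (q + q' - 1) (P + P' - T).
  move=> q2 q'2 P_in P'_in.
  have [P_mon _ sP PT P0] := P_in; have [P'_mon _ sP' P'T P'0] := P'_in.
  have [S_mon sS] := monic_oplus P_mon P'_mon T_mon sP sP'.
  split=> //.
  - split; first by rewrite size_map_inj_poly ?sS ?T_deg; [lia|exact: intr_inj|].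
    move=> z; rewrite map_real_complex_int.
    by apply: (oplus_no_root T_mon T_rec T_simple T1 t_gt1 Tt t_only);
      [exists q|exists q'].
  (* (z - 1) T = z T - T^* holds because T is reciprocal. *)
  - rewrite /poly_over recip_oplus // T_rec.
    rewrite -[recip P](subKr ('X * P)) -PT -[recip P'](subKr ('X * P')) -P'T.
    ring.
  - by rewrite !hornerD hornerN P0 P'0 T0_eq1.
split=> [q q' P P' q2 q'2 P_in P'_in /=|].
  have S_in := oplus_Eplus _ _ _ _ q2 q'2 P_in P'_in.
  by have [S_mon S_exp sS ST _] := S_in; split=> //; rewrite sS.
have oplusT P : oplus T P T = P by rewrite /oplus addrK.
have oplusC P Q : oplus T P Q = oplus T Q P by rewrite /oplus [P + Q]addrC.
split; first split=> [P Q|P Q U _ _ _|P Q _ _].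
- case=> [[q q2 P_in]|->] [[q' q'2 Q_in]|->].
  + left; exists (q + q' - 1); last exact: oplus_Eplus.
    by move: q2 q'2 => /= q2 q'2; lia.
  + by rewrite oplusT; left; exists q.
  + by rewrite oplusC oplusT; left; exists q'.
  + by rewrite oplusT; right.
- by rewrite /oplus; ring.
- exact: oplusC.
by split=> [|P _]; [right|rewrite oplusC oplusT].
Qed.
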